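(* Let $q$ be a prime power and let $A$ be a nonempty subset of $\mathbb{F}_q$. Suppose that there is a positive constant $K$ such that $|A|\le q/(4K)$ and \[ D_\times(A)\ \ge\ \frac{|A|^8}{q}+\frac{3q|A|^5}{K}. \] Then there exists a subset $X\subseteq\mathbb{F}_q^*$ such that $E(A,\xi A)\ge |A|^3/K$ for all $\xi\in X$ and \[ \frac{q}{K|A|}\ \le\ |X|\ \le\ \frac{4Kq}{3|A|}. \]
   Context: $\mathbb{F}_q$ is the finite field with $q$ elements and $\mathbb{F}_q^*=\mathbb{F}_q\setminus\{0\}$. For $A\subseteq\mathbb{F}_q$, \[ D_\times(A)=|\{(a_1,\dots,a_8)\in A^8: (a_1-a_2)(a_3-a_4)=(a_5-a_6)(a_7-a_8)\}|, \] and for $\xi\in\mathbb{F}_q^*$, \[ E(A,\xi A)=|\{(a_1,a_2,a_3,a_4)\in A^4: a_1-a_2=\xi(a_3-a_4)\}|. \] *)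

(* Defs.v *)
From mathcomp Require Import all_boot all_order all_algebra.
From mathcomp Require Import reals.

Set Implicit Arguments.
Unset Strict Implicit.
Unset Printing Implicit Defensive.

Import Order.TTheory GRing.Theory Num.Theory.

Local Open Scope ring_scope.

(* Tuple entries are indexed from 0, so a`_i stands for the entry usually
   written a_(i+1). *)

Definition Dtimes (F : finFieldType) (A : {set F}) : nat :=
  #|[set a : 8.-tuple F | all (mem A) a
      && ((a`_0 - a`_1) * (a`_2 - a`_3) == (a`_4 - a`_5) * (a`_6 - a`_7))]|.

(* E(A, xi A), the additive energy of A and its dilate by xi (for xi != 0). *)
Definition dilate_energy (F : finFieldType) (A : {set F}) (xi : F) : nat :=
  #|[set a : 4.-tuple F | all (mem A) a
      && (a`_0 - a`_1 == xi * (a`_2 - a`_3))]|.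

(* Main.v *)
(* Let r(x) be the number of representations x = a - b in A, N = |A| and
   E(xi) = E(A, xi A) = sum_y r(xi y) r(y).  Sorting the solutions of
   x y = z w by ratio gives
     sum_(xi <> 0) E(xi)   = N^4 - 2 N^3 + q N^2,
     sum_(xi <> 0) E(xi)^2 = D(A) + q N^4 - 2 N^6,
   and Cauchy-Schwarz gives E(xi) >= N^4/q, so that e = E - N^4/q is
   nonnegative with sum at most q N^2.  Take X = {xi <> 0 : E(xi) >= N^3/K}.
   As N <= q/(4K), e is at least 3 N^3/(4K) on X, which bounds |X| above.
   The hypothesis on D(A) makes the sum of e^2 at least 2 q N^5/K; at most
   q N^5/K of it comes from outside X, and e^2 <= N^6 on X bounds |X| below. *)

Require Import Defs.
From mathcomp Require Import all_boot all_order all_algebra.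
From mathcomp Require Import reals.
From mathcomp Require Import ring lra.

Set Implicit Arguments.
Unset Strict Implicit.

Import Order.TTheory GRing.Theory Num.Theory.
Local Open Scope ring_scope.

(** * Tuple sums as iterated sums *)

Lemma sum_tuple0 (V : nmodType) (T : finType) (P : pred T) (f : seq T -> V) :
  \sum_(t : 0.-tuple T | all P t) f t = f [::].
Proof.
rewrite (big_pred1 [tuple]) // => t.
by rewrite /= (tuple0 t) (eqxx ([tuple] : 0.-tuple T)).
Qed.

(** Splits off the head of the tuple. Since [f] takes a sequence rather than a tuple, one [f] can be
    followed through all lengths. *)
Lemma sum_tupleS (V : nmodType) (T : finType) (n : nat) (P : pred T)
    (f : seq T -> V) :
  \sum_(t : n.+1.-tuple T | all P t) f t =
  \sum_(x | P x) \sum_(t : n.-tuple T | all P t) f (x :: t).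
Proof.
rewrite pair_big_dep /=.
rewrite (reindex (fun p : T * n.-tuple T => [tuple of p.1 :: p.2])) //=.
exists (fun t : n.+1.-tuple T => (thead t, [tuple of behead t])) => [[x t] _|t _].
  by congr pair; apply: val_inj.
by rewrite /= -tuple_eta.
Qed.

Lemma card_tuple_sum (R : nzSemiRingType) (T : finType) (n : nat) (A : {set T})
    (Q : pred (seq T)) :
  #|[set t : n.-tuple T | all (mem A) t && Q t]|%:R =
  \sum_(t : n.-tuple T | all (mem A) t) (Q t)%:R :> R.
Proof.
rewrite cardsE -sum1_card natr_sum (eq_bigl _ _ (fun t => unfold_in _ _)) /=.
by rewrite big_mkcondr; apply: eq_bigr => t _; case: (Q t).
Qed.

Lemma sum_tupleS4 (V : nmodType) (T : finType) (n : nat) (A : {set T})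
    (f : seq T -> V) :
  \sum_(t : n.+4.-tuple T | all (mem A) t) f t =
  \sum_(a in A) \sum_(b in A) \sum_(c in A) \sum_(d in A)
    \sum_(t : n.-tuple T | all (mem A) t) f [:: a, b, c, d & t].
Proof.
rewrite (sum_tupleS _ _ f); apply: eq_bigr => a _.
rewrite (sum_tupleS _ _ (fun s => f (a :: s))); apply: eq_bigr => b _.
rewrite (sum_tupleS _ _ (fun s => f [:: a, b & s])); apply: eq_bigr => c _.
by rewrite (sum_tupleS _ _ (fun s => f [:: a, b, c & s])).
Qed.

(** * First and second moments of a ratio correlation over a finite field *)

Section Quotients.
Variables (R : comNzRingType) (F : finFieldType) (g : F -> R).

(** For [g] the difference count of [A], this is E(A, xi A). *)
Definition ratio_corr (xi : F) : R := \sum_y g (xi * y) * g y.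

Lemma sum_dilate (c : F) : c != 0 ->
  \sum_(xi | xi != 0) g (xi * c) = \sum_x g x - g 0.
Proof.
move=> c0; apply/eqP; rewrite eq_sym subr_eq; apply/eqP.
rewrite (reindex (fun x => x * c)) /=; last first.
  by exists (fun x => x / c) => x _; rewrite ?mulfK ?divfK.
by rewrite (bigD1 0) //= mul0r addrC.
Qed.

Lemma sum1_nonzero : \sum_(xi : F | xi != 0) 1 = #|F|%:R - 1 :> R.
Proof.
apply/eqP; rewrite eq_sym subr_eq; apply/eqP.
by rewrite -sum1_card natr_sum (bigD1 0) //= addrC.
Qed.

(** For y != 0 the product xi y runs over all nonzero elements, so these y give (G - g 0)^2 with G
    the sum of [g]; y = 0 gives (q - 1) (g 0)^2. *)
Lemma sum_ratio_corr :
  \sum_(xi | xi != 0) ratio_corr xi =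
  (\sum_x g x) ^+ 2 - 2 * (\sum_x g x) * g 0 + #|F|%:R * g 0 ^+ 2.
Proof.
rewrite /ratio_corr exchange_big /= (bigD1 0) //=.
rewrite (eq_bigr (fun=> 1 * (g 0 * g 0))); last by move=> xi _; rewrite mulr0 mul1r.
rewrite -mulr_suml sum1_nonzero.
rewrite (eq_bigr (fun y => (\sum_x g x - g 0) * g y)); last first.
  by move=> y y0; rewrite -mulr_suml sum_dilate.
rewrite -mulr_sumr.
have -> : \sum_(y | y != 0) g y = \sum_x g x - g 0.
  by rewrite [\sum_x g x](bigD1 0) //= [g 0 + _]addrC addrK.
ring.
Qed.

(* If (y, w) != 0, the solutions (x, z) of x w = z y form the line through
   (y, w), parametrised by xi |-> (xi y, xi w). *)
Lemma sum_line (y w : F) : (y != 0) || (w != 0) ->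
  \sum_x \sum_z (x * w == z * y)%:R * (g x * g z) =
  \sum_xi g (xi * y) * g (xi * w).
Proof.
have line (c d : F) : c != 0 ->
    \sum_x \sum_z (x * d == z * c)%:R * (g x * g z) =
    \sum_xi g (xi * c) * g (xi * d).
  move=> c0; rewrite (reindex (fun x => x * c)) /=; last first.
    by exists (fun x => x / c) => x _; rewrite ?mulfK ?divfK.
  apply: eq_bigr => x _; rewrite (bigD1 (x * d)) //= mulrAC eqxx mul1r.
  rewrite big1 ?addr0 // => z zx.
  have -> : (x * d * c == z * c) = (z == x * d).
    by rewrite eq_sym; apply: (inj_eq (mulIf c0)).
  by rewrite (negPf zx) mul0r.
case/orP=> [/line-> //|/line-/(_ y) E].
under [RHS]eq_bigr => xi _ do rewrite mulrC.
rewrite -E exchange_big /=; apply: eq_bigr => x _; apply: eq_bigr => z _.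
by rewrite eq_sym [g z * _]mulrC.
Qed.

(** Both sides are sorted by the pair (y, w). A nonzero pair has a line of solutions (x, z), whose
    points xi != 0 match the expanded squares and whose point xi = 0 adds (g 0)^2. The pair (0, 0)
    allows every (x, z) on the right and gives (q - 1) (g 0)^4 on the left. *)
Lemma sum_ratio_corr_sqr :
  \sum_(xi | xi != 0) ratio_corr xi ^+ 2 =
  \sum_x \sum_y \sum_z \sum_w (x * y == z * w)%:R * (g x * g y * g z * g w)
  + #|F|%:R * g 0 ^+ 4 - 2 * g 0 ^+ 2 * (\sum_x g x) ^+ 2.
Proof.
set G := \sum_x g x.
pose S (y w : F) := \sum_x \sum_z (x * y == z * w)%:R * (g x * g z).
have -> : \sum_x \sum_y \sum_z \sum_w
    (x * y == z * w)%:R * (g x * g y * g z * g w) =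
    \sum_p g p.1 * g p.2 * S p.1 p.2.
  rewrite exchange_big /= -[RHS](pair_big xpredT xpredT (fun y w => g y * g w * S y w)) /=.
  apply: eq_bigr => y _.
  under eq_bigr => x _ do rewrite exchange_big /=.
  rewrite exchange_big /=; apply: eq_bigr => w _.
  rewrite mulr_sumr; apply: eq_bigr => x _; rewrite mulr_sumr.
  by apply: eq_bigr => z _; ring.
have S0 : S 0 0 = G ^+ 2.
  rewrite /S /G expr2 mulr_suml; apply: eq_bigr => x _.
  by rewrite mulr_sumr; apply: eq_bigr => z _; rewrite !mulr0 eqxx mul1r.
have SN p : p != (0, 0) ->
    S p.1 p.2 = \sum_(xi | xi != 0) g (xi * p.2) * g (xi * p.1) + g 0 ^+ 2.
  case: p => y w; rewrite xpair_eqE negb_and orbC => yw.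
  rewrite /S sum_line // (bigD1 0) //= !mul0r addrC; congr (_ + _).
rewrite (bigD1 (0, 0)) //= S0.
rewrite (eq_bigr (fun p => \sum_(xi | xi != 0)
    g p.1 * g p.2 * (g (xi * p.2) * g (xi * p.1)) + g p.1 * g p.2 * g 0 ^+ 2));
  last by move=> p p0; rewrite SN // mulrDr mulr_sumr.
rewrite big_split /= -mulr_suml.
have GG : \sum_(p : F * F) g p.1 * g p.2 = G ^+ 2.
  rewrite -(pair_big xpredT xpredT (fun y w => g y * g w)) /= expr2 mulr_suml.
  by apply: eq_bigr => y _; rewrite mulr_sumr.
have -> : \sum_(p : F * F | p != (0, 0)) g p.1 * g p.2 = G ^+ 2 - g 0 ^+ 2.
  by rewrite -GG [in RHS](bigD1 (0, 0)) //= -expr2 [_ ^+ 2 + _]addrC addrK.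
rewrite exchange_big /=.
have -> : \sum_(xi | xi != 0) ratio_corr xi ^+ 2 =
    \sum_(xi | xi != 0) (\sum_(p | p != (0, 0))
      g p.1 * g p.2 * (g (xi * p.2) * g (xi * p.1)) + 1 * g 0 ^+ 4).
  apply: eq_bigr => xi _; rewrite /ratio_corr expr2 mulr_suml.
  under eq_bigr => y _ do rewrite mulr_sumr.
  rewrite (pair_big xpredT xpredT
    (fun y w => g (xi * y) * g y * (g (xi * w) * g w))) /=.
  rewrite (bigD1 (0, 0)) //= mulr0 addrC; congr (_ + _); last by ring.
  by apply: eq_bigr => p _; ring.
rewrite big_split /= -mulr_suml sum1_nonzero.
ring.
Qed.

End Quotients.

(** * Difference counts and the energies of dilates *)

Section Differences.
Variables (R : realFieldType) (F : finFieldType) (A : {set F}).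
Local Notation N := (#|A|%:R : R).
Local Notation E xi := ((dilate_energy A xi)%:R : R).

(** The map [u] is kept general: a - b yields the difference count, and a - xi c the count to which
    Cauchy-Schwarz is applied. *)
Definition fiber_count (u : F -> F -> F) (x : F) : R :=
  \sum_(a in A) \sum_(b in A) (u a b == x)%:R.

Lemma sum_fiber (u : F -> F -> F) (f : F -> R) :
  \sum_(a in A) \sum_(b in A) f (u a b) = \sum_x fiber_count u x * f x.
Proof.
rewrite /fiber_count; under [RHS]eq_bigr => x _ do rewrite mulr_suml.
rewrite [RHS]exchange_big /=; apply: eq_bigr => a _.
under [RHS]eq_bigr => x _ do rewrite mulr_suml.
rewrite [RHS]exchange_big /=; apply: eq_bigr => b _.
rewrite [RHS](bigD1 (u a b)) //= eqxx mul1r big1 ?addr0 // => x.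
by rewrite eq_sym => /negPf->; rewrite mul0r.
Qed.

Lemma sum_const_card (c : R) : \sum_(a in A) c = N * c.
Proof. by rewrite sumr_const mulr_natl. Qed.

Lemma sum_fiber_count (u : F -> F -> F) : \sum_x fiber_count u x = N ^+ 2.
Proof.
under eq_bigr => x _ do rewrite -[fiber_count u x]mulr1.
by rewrite -(sum_fiber u (fun=> 1)) !sum_const_card mulr1.
Qed.

Definition diff_count : F -> R := fiber_count (fun a b => a - b).

Lemma sum_indicator (c : F) : \sum_(b in A) (b == c)%:R = (c \in A)%:R :> R.
Proof.
have [cA|cA] := boolP (c \in A).
  rewrite (bigD1 c) //= eqxx big1 ?addr0 // => b /andP[_ /negPf->] //.
by rewrite big1 // => b bA; case: eqP => // bc; rewrite -bc bA in cA.
Qed.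

Lemma diff_countE (x : F) : diff_count x = \sum_(a in A) (a - x \in A)%:R.
Proof.
apply: eq_bigr => a _; rewrite -sum_indicator; apply: eq_bigr => b _.
by rewrite subr_eq addrC -subr_eq eq_sym.
Qed.

Lemma diff_count0 : diff_count 0 = N.
Proof.
rewrite diff_countE -[RHS]mulr1 -[RHS]sum_const_card.
by apply: eq_bigr => a aA; rewrite subr0 aA.
Qed.

Lemma diff_count_ge0 (x : F) : 0 <= diff_count x.
Proof. by apply: sumr_ge0 => a _; apply: sumr_ge0. Qed.

Lemma diff_count_le (x : F) : diff_count x <= N.
Proof.
rewrite diff_countE -[leRHS]mulr1 -[leRHS]sum_const_card.
by apply: ler_sum => a _; case: (_ \in A).
Qed.

Lemma dilate_energy_sum (xi : F) :
  E xi = \sum_(a in A) \sum_(b in A) \sum_(c in A) \sum_(d in A)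
           (a - b == xi * (c - d))%:R.
Proof.
rewrite /dilate_energy (card_tuple_sum R _ A
  (fun a : seq F => a`_0 - a`_1 == xi * (a`_2 - a`_3))).
rewrite (sum_tupleS4 _ A (fun a : seq F => (a`_0 - a`_1 == xi * (a`_2 - a`_3))%:R)).
do 4!(apply: eq_bigr => ? _).
exact: (sum_tuple0 _ (fun s => ([:: _, _, _, _ & s]`_0 - _ == _)%:R)).
Qed.

Lemma dilate_energyE (xi : F) : E xi = ratio_corr diff_count xi.
Proof.
rewrite dilate_energy_sum (sum_fiber (fun a b => a - b)
  (fun x => \sum_(c in A) \sum_(d in A) (x == xi * (c - d))%:R)).
under eq_bigr => x _ do rewrite (sum_fiber (fun c d => c - d)
  (fun y => (x == xi * y)%:R)) mulr_sumr.
rewrite exchange_big /=; apply: eq_bigr => y _.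
rewrite (bigD1 (xi * y)) //= eqxx mulr1 big1 ?addr0 // => x /negPf->.
by rewrite !mulr0.
Qed.

Lemma DtimesE :
  (Dtimes A)%:R = \sum_x \sum_y \sum_z \sum_w (x * y == z * w)%:R *
    (diff_count x * diff_count y * diff_count z * diff_count w).
Proof.
pose f (a : seq F) : R :=
  ((a`_0 - a`_1) * (a`_2 - a`_3) == (a`_4 - a`_5) * (a`_6 - a`_7))%:R.
rewrite /Dtimes (card_tuple_sum R _ A (fun a : seq F =>
  (a`_0 - a`_1) * (a`_2 - a`_3) == (a`_4 - a`_5) * (a`_6 - a`_7))).
pose sub (a b : F) := a - b.
transitivity (\sum_(a in A) \sum_(b in A) \sum_(c in A) \sum_(d in A)
  \sum_(a' in A) \sum_(b' in A) \sum_(c' in A) \sum_(d' in A)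
   (sub a b * sub c d == sub a' b' * sub c' d')%:R : R).
  rewrite (sum_tupleS4 _ A f); do 4!(apply: eq_bigr => ? _).
  rewrite (sum_tupleS4 _ A (fun s => f [:: _, _, _, _ & s])).
  do 4!(apply: eq_bigr => ? _).
  exact: (sum_tuple0 _ (fun s => f [:: _, _, _, _, _, _, _, _ & s])).
have sumE (h : F -> R) : \sum_(a in A) \sum_(b in A) h (sub a b) =
    \sum_x diff_count x * h x by exact: sum_fiber.
move: diff_count sumE => r sumE.
rewrite (sumE (fun x => \sum_(c in A) \sum_(d in A)
  \sum_(a' in A) \sum_(b' in A) \sum_(c' in A) \sum_(d' in A)
   (x * sub c d == sub a' b' * sub c' d')%:R)).
apply: eq_bigr => x _.
rewrite (sumE (fun y => \sum_(a' in A) \sum_(b' in A)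
  \sum_(c' in A) \sum_(d' in A) (x * y == sub a' b' * sub c' d')%:R)).
rewrite mulr_sumr; apply: eq_bigr => y _.
rewrite (sumE (fun z =>
  \sum_(c' in A) \sum_(d' in A) (x * y == z * sub c' d')%:R)).
rewrite !mulr_sumr; apply: eq_bigr => z _.
rewrite (sumE (fun w => (x * y == z * w)%:R)).
by rewrite !mulr_sumr; apply: eq_bigr => w _; ring.
Qed.

Lemma sum_dilate_energy :
  \sum_(xi | xi != 0) E xi = N ^+ 4 - 2 * N ^+ 3 + #|F|%:R * N ^+ 2.
Proof.
under eq_bigr => xi _ do rewrite dilate_energyE.
by rewrite sum_ratio_corr sum_fiber_count diff_count0; ring.
Qed.

Lemma sum_dilate_energy_sqr :
  \sum_(xi | xi != 0) E xi ^+ 2 =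
  (Dtimes A)%:R + #|F|%:R * N ^+ 4 - 2 * N ^+ 6.
Proof.
under eq_bigr => xi _ do rewrite dilate_energyE.
by rewrite sum_ratio_corr_sqr -DtimesE sum_fiber_count diff_count0; ring.
Qed.

(** In the sum of r(xi y) r(y), the first factor is at most N and the second sums to N^2. *)
Lemma dilate_energy_le (xi : F) : E xi <= N ^+ 3.
Proof.
rewrite dilate_energyE exprS -(sum_fiber_count (fun a b => a - b)) mulr_sumr.
by apply: ler_sum => y _; rewrite ler_wpM2r ?diff_count_ge0 ?diff_count_le.
Qed.

(** The equation a - b = xi (c - d) is the collision a - xi c = b - xi d. *)
Lemma dilate_energy_sumsqr (xi : F) :
  E xi = \sum_x fiber_count (fun a c => a - xi * c) x ^+ 2.
Proof.
rewrite dilate_energy_sum; under [RHS]eq_bigr => x _ do rewrite expr2.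
rewrite -(sum_fiber _ (fiber_count _)); apply: eq_bigr => a _.
rewrite exchange_big /=; apply: eq_bigr => c _.
apply: eq_bigr => b _; apply: eq_bigr => d _.
rewrite [in RHS]eq_sym -subr_eq0 -[in RHS]subr_eq0.
by congr (nat_of_bool (_ == 0))%:R; ring.
Qed.

(** Cauchy-Schwarz in variance form: the fiber counts of a - xi c have mean N^2/q, and their squared
    deviations have a nonnegative sum. *)
Lemma dilate_energy_ge (xi : F) : N ^+ 4 / #|F|%:R <= E xi.
Proof.
have q0 : 0 < #|F|%:R :> R by rewrite ltr0n; apply/card_gt0P; exists 0.
set q := #|F|%:R in q0 *; set u := fun a c => a - xi * c.
have : 0 <= \sum_x (q * fiber_count u x - N ^+ 2) ^+ 2.
  by apply: sumr_ge0 => x _; apply: sqr_ge0.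
have -> : \sum_x (q * fiber_count u x - N ^+ 2) ^+ 2 =
    \sum_x (q ^+ 2 * fiber_count u x ^+ 2 -
            2 * q * N ^+ 2 * fiber_count u x + N ^+ 4).
  by apply: eq_bigr => x _; ring.
rewrite big_split sumrB /= -!mulr_sumr -dilate_energy_sumsqr sum_fiber_count.
rewrite sumr_const -mulr_natl -/q ler_pdivrMr // => h.
rewrite -subr_ge0 -(pmulr_rge0 _ q0).
by apply: le_trans h _; rewrite le_eqVlt; apply/orP; left; apply/eqP; ring.
Qed.

End Differences.

(** * Size of the set of ratios with large energy *)

Theorem theoremB (R : realType) (q : nat) (F : finFieldType) (hq : #|F| = q)
    (A : {set F}) (hA : A != set0) (K : R) (hK : 0 < K)
    (hAK : #|A|%:R <= q%:R / (4 * K))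
    (hD : #|A|%:R ^+ 8 / q%:R + 3 * q%:R * #|A|%:R ^+ 5 / K
            <= (Dtimes A)%:R) :
  exists X : {set F},
    [/\ X \subset [set~ 0],
        forall xi : F, xi \in X ->
          #|A|%:R ^+ 3 / K <= (dilate_energy A xi)%:R,
        q%:R / (K * #|A|%:R) <= #|X|%:R
      & #|X|%:R <= 4 * K * q%:R / (3 * #|A|%:R)].
Proof.
subst q.
have N0 : 0 < #|A|%:R :> R by rewrite ltr0n card_gt0.
have Nq : #|A|%:R <= #|F|%:R :> R by rewrite ler_nat max_card.
have S1 := sum_dilate_energy R A.
have S2 := sum_dilate_energy_sqr R A.
have S0 := sum1_nonzero R F.
have Ele xi := dilate_energy_le R A xi.
have Ege xi := dilate_energy_ge R A xi.
set X := [set xi | (xi != 0) && (#|A|%:R ^+ 3 / K <= (dilate_energy A xi)%:R :> R)].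
exists X.
have cardX (c : R) : \sum_(xi | xi != 0) (xi \in X)%:R * c = #|X|%:R * c.
  rewrite -mulr_suml; congr (_ * c); rewrite -sum1_card natr_sum.
  rewrite [RHS]big_mkcond [LHS]big_mkcond; apply: eq_bigr => xi _.
  by rewrite inE; case: (xi != 0) => //=; case: (_ <= _).
set E := fun xi => (dilate_energy A xi)%:R : R.
set N := #|A|%:R in N0 Nq hAK hD S1 S2 Ele Ege X cardX *.
set q := #|F|%:R in Nq hAK hD S0 S1 S2 Ele Ege *.
have q0 : 0 < q := lt_le_trans N0 Nq.
(* With 1/K and N/q named, the estimates become polynomial, with N = q t as the link between [t] and
   [q]. *)
pose k := K^-1; pose t := N / q.
have k0 : 0 < k by rewrite invr_gt0.
have t0 : 0 < t by rewrite divr_gt0.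
have t1 : t <= 1 by rewrite ler_pdivrMr // mul1r.
have qt : N = q * t by rewrite mulrC divfK // gt_eqF.
have N4q : N ^+ 4 / q = N ^+ 3 * t by rewrite exprSr -mulrA.
have N8q : N ^+ 8 / q = N ^+ 7 * t by rewrite exprSr -mulrA.
clearbody t.
have hk : 4 * N <= q * k.
  by move: hAK; rewrite !ler_pdivlMr ?mulr_gt0 // mulrCA mulrA.
have X_le xi : xi \in X -> N ^+ 3 * k <= E xi by rewrite inE => /andP[].
pose e xi := E xi - N ^+ 3 * t.
have e_ge0 xi : 0 <= e xi by rewrite subr_ge0 -N4q; apply: Ege.
have sum_c c : \sum_(xi : F | xi != 0) c = (q - 1) * c.
  by rewrite -S0 mulr_suml; apply: eq_bigr => xi _; rewrite mul1r.
have sum_e : \sum_(xi | xi != 0) e xi <= q * N ^+ 2.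
  rewrite sumrB S1 sum_c -subr_ge0.
  have -> : q * N ^+ 2 -
      (N ^+ 4 - 2 * N ^+ 3 + q * N ^+ 2 - (q - 1) * (N ^+ 3 * t)) =
      N ^+ 3 * (2 - t) + N ^+ 3 * (q * t - N) by ring.
  by rewrite -qt subrr mulr0 addr0 mulr_ge0 ?exprn_ge0 ?ltW //; lra.
(* Expanding the square costs 4 N^6: half from the second moment, half from the cross term. One of
   the three shares q N^5 k in [hD] pays for it by [hk], and two remain. *)
have sum_e2 : 2 * q * N ^+ 5 * k <= \sum_(xi | xi != 0) e xi ^+ 2.
  have -> : \sum_(xi | xi != 0) e xi ^+ 2 = \sum_(xi | xi != 0)
      (E xi ^+ 2 - 2 * N ^+ 3 * t * E xi + N ^+ 6 * t ^+ 2).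
    by apply: eq_bigr => xi _; rewrite /e; ring.
  rewrite big_split sumrB /= -mulr_sumr S2 S1 sum_c.
  rewrite N8q -/k in hD.
  rewrite -subr_ge0 in hD; rewrite -subr_ge0 in hk; rewrite -subr_ge0.
  (* The last summand vanishes by N = q t; the others are nonnegative by [hD], [hk], positivity and
     t <= 1. *)
  have -> : forall D, D + q * N ^+ 4 - 2 * N ^+ 6
      - 2 * N ^+ 3 * t * (N ^+ 4 - 2 * N ^+ 3 + q * N ^+ 2)
      + (q - 1) * (N ^+ 6 * t ^+ 2) - 2 * q * N ^+ 5 * k =
      (D - (N ^+ 7 * t + 3 * q * N ^+ 5 * k)) + N ^+ 5 * (q * k - 4 * N)
      + q * N ^+ 4 + N ^+ 6 * t * (4 - t)
      + (q * t - N) * (N ^+ 6 * t - 2 * N ^+ 5) by move=> D; ring.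
  rewrite -qt subrr mul0r addr0.
  apply: addr_ge0; last first.
    have t4 : 0 <= 4 - t by lra.
    by rewrite !mulr_ge0 ?exprn_ge0 ?(ltW t0) ?(ltW N0).
  apply: addr_ge0; last by rewrite mulr_ge0 ?exprn_ge0 ?ltW.
  by apply: addr_ge0 => //; rewrite mulr_ge0 // ?exprn_ge0 ?ltW.
split.
- by apply/subsetP => xi; rewrite !inE => /andP[].
- exact: X_le.
(* On [X], e <= E <= N^3. Off [X], e <= E < N^3 k bounds only one factor of e^2, and the other is
   kept for [sum_e]. *)
- have : \sum_(xi | xi != 0) e xi ^+ 2 <=
      \sum_(xi | xi != 0) ((xi \in X)%:R * N ^+ 6 + N ^+ 3 * k * e xi).
    apply: ler_sum => xi xi0; have := e_ge0 xi.
    have [xiX|xiX] := boolP (xi \in X).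
      rewrite mul1r => e0; apply: ler_wpDr.
        by rewrite !mulr_ge0 ?exprn_ge0 // ?ltW.
      rewrite -[6%N]/(3 * 2)%N exprM lerXn2r ?nnegrE ?exprn_ge0 // ?(ltW N0) //.
      apply: le_trans (Ele xi); rewrite gerBl mulr_ge0 ?exprn_ge0 ?ltW //.
    rewrite mul0r add0r expr2 => e0; apply: ler_wpM2r => //.
    move: xiX; rewrite inE xi0 /= -ltNge => /ltW; apply: le_trans.
    by rewrite gerBl mulr_ge0 ?exprn_ge0 ?ltW.
  rewrite big_split /= cardX -mulr_sumr => h.
  have N3k : 0 <= N ^+ 3 * k by rewrite mulr_ge0 ?exprn_ge0 ?ltW.
  have h2 := ler_wpM2l N3k sum_e.
  have : N ^+ 5 * (q * k) <= N ^+ 5 * (#|X|%:R * N) by lra.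
  rewrite ler_pM2l ?exprn_gt0 // invfM mulrA -/k.
  by rewrite (ler_pdivrMr _ _ N0).
(* The factor 3/4 arises because [hk] reads 4 t <= k, so the subtracted N^3 t is at most a quarter
   of N^3 k. *)
- have : \sum_(xi | xi != 0) (xi \in X)%:R * (3 / 4 * N ^+ 3 * k) <=
      \sum_(xi | xi != 0) e xi.
    apply: ler_sum => xi xi0; have [/X_le xiX|_] := boolP (xi \in X).
      have : N ^+ 3 * (4 * t) <= N ^+ 3 * k.
        rewrite ler_pM2l ?exprn_gt0 // -(ler_pM2l q0).
        by rewrite mulrCA -qt.
      rewrite /e mul1r; lra.
    by rewrite mul0r.
  rewrite cardX => /le_trans/(_ sum_e) h.
  (* Scaling the goal by k N^2 turns it into four times [h], since K k = 1. *)
  rewrite ler_pdivlMr ?mulr_gt0 // -(ler_pM2r k0).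
  rewrite -(ler_pM2l (exprn_gt0 2 N0)).
  have -> : N ^+ 2 * (4 * K * q * k) = 4 * (q * N ^+ 2) * (K * k) by ring.
  rewrite /k divff ?gt_eqF // -/k mulr1.
  lra.
Qed.
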